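(* The grid $G(4,5)$ can be fully contaminated from only three initially contaminated cells, i.e. there exists $S\subseteq V_{4,5}$ with $|S|=3$ and $C(S)=V_{4,5}$. Consequently, it is false that for all integers $n,m\ge 1$ $$\gamma_c(G(n,m)) = \begin{cases} \max\left\{\left\lfloor \frac m2\right\rfloor,\left\lfloor \frac n2\right\rfloor\right\}+1, & \text{if } m \text{ and } n \text{ have the same parity},\\[0.6em] \max\left\{\left\lceil \frac m2\right\rceil,\left\lceil \frac n2\right\rceil\right\}+1, & \text{otherwise},\end{cases}$$ since for $(n,m)=(4,5)$ this formula gives the value $4$.
   Context: For integers $n,m\ge 1$, the grid $G(n,m)$ has cell set $V_{n,m}=\{(i,j): 1\le i\le n,\ 1\le j\le m\}$ ($i$ = row, $j$ = column). Contamination rules: a cell $u=(i,j)\in V_{n,m}$ can be contaminated by two contaminated cells $v,w\in V_{n,m}$ if one of the following holds: (a) $v=(i-1,j-1)$, $w=(i+1,j+1)$; (b) $v=(i+1,j-1)$, $w=(i-1,j+1)$; (c) $v=(i-1,j)$, $w=(i+1,j)$; (d) $v=(i,j-1)$, $w=(i,j+1)$; (e) $v=(i,j-1)$, $w=(i-1,j)$; (f) $v=(i,j-1)$, $w=(i+1,j)$; (g) $v=(i+1,j)$, $w=(i,j+1)$; (h) $v=(i-1,j)$, $w=(i,j+1)$. For $S\subseteq V_{n,m}$, the final contaminated set $C(S)$ is the smallest subset of $V_{n,m}$ containing $S$ and closed under rules (a)--(h). $S$ is a contaminating set (it fully contaminates the grid) if $C(S)=V_{n,m}$. The power contamination number $\gamma_c(G(n,m))$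 is the minimum cardinality of a contaminating set. *)

(* Defs.v *)
From mathcomp Require Import all_boot all_order all_algebra.

Set Implicit Arguments.
Unset Strict Implicit.
Unset Printing Implicit Defensive.

Import GRing.Theory.

(* Rows and columns are numbered from 0 instead of 1; the contamination rules
   only involve differences of coordinates, so they are unaffected. *)
Definition cell (n m : nat) : finType := ('I_n * 'I_m)%type.

(* v = (i + a, j + b), where u = (i, j).  Working in int avoids truncated
   subtraction; v being a cell forces the shifted position to be in the grid. *)
Definition shifted n m (u : cell n m) (a b : int) (v : cell n m) : bool :=
  (v.1%:Z == u.1%:Z + a)%R && (v.2%:Z == u.2%:Z + b)%R.

Definition contaminates n m (v w u : cell n m) : bool :=
  [|| (* a *) shifted u (-1) (-1) v && shifted u 1 1 w,
      (* b *) shifted u 1 (-1) v && shifted u (-1) 1 w,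
      (* c *) shifted u (-1) 0 v && shifted u 1 0 w,
      (* d *) shifted u 0 (-1) v && shifted u 0 1 w,
      (* e *) shifted u 0 (-1) v && shifted u (-1) 0 w,
      (* f *) shifted u 0 (-1) v && shifted u 1 0 w,
      (* g *) shifted u 1 0 v && shifted u 0 1 w
    | (* h *) shifted u (-1) 0 v && shifted u 0 1 w].

Definition contamination_closed n m (T : {set cell n m}) : bool :=
  [forall u, forall v, forall w,
     [&& v \in T, w \in T & contaminates v w u] ==> (u \in T)].

Definition final_contaminated n m (S : {set cell n m}) : {set cell n m} :=
  \bigcap_(T : {set cell n m} | (S \subset T) && contamination_closed T) T.

(* The intersection above is itself closed, hence the smallest closed superset. *)
Lemma final_contaminatedP n m (S : {set cell n m}) :
  [/\ S \subset final_contaminated S,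
      contamination_closed (final_contaminated S)
    & forall T : {set cell n m}, S \subset T -> contamination_closed T ->
        final_contaminated S \subset T].
Proof.
split.
- by apply/bigcapsP => T /andP[].
- apply/forallP => u; apply/forallP => v; apply/forallP => w.
  apply/implyP => /and3P[/bigcapP vS /bigcapP wS uvw].
  apply/bigcapP => T hT; have /andP[_ /forallP/(_ u)] := hT.
  move=> /forallP/(_ v)/forallP/(_ w)/implyP; apply.
  by rewrite vS // wS.
- by move=> T ST cT; apply: bigcap_inf; rewrite ST.
Qed.

Definition contaminating n m (S : {set cell n m}) : bool :=
  final_contaminated S == [set: cell n m].

Lemma contaminating_setT n m : contaminating [set: cell n m].
Proof.
have [h _ _] := final_contaminatedP [set: cell n m].
by rewrite /contaminating eqEsubset subsetT.
Qed.

Definition power_contamination_number (n m : nat) : nat :=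
  #|[arg min_(S < [set: cell n m] | contaminating S) #|S| ]|.

(* The default value of the arg min is admissible, so the minimum is attained. *)
Lemma power_contamination_numberP n m :
  (exists2 S : {set cell n m},
     contaminating S & #|S| = power_contamination_number n m) /\
  (forall S : {set cell n m},
     contaminating S -> power_contamination_number n m <= #|S|).
Proof.
rewrite /power_contamination_number.
case: arg_minnP => [|S cS minS]; first exact: contaminating_setT.
by split; first exists S.
Qed.

Definition claimed_value (n m : nat) : nat :=
  if odd m == odd n then maxn m./2 n./2 + 1
  else maxn (uphalf m) (uphalf n) + 1.

(* Main.v *)
Require Import Defs.
From mathcomp Require Import all_boot all_order all_algebra.

(** Three cells suffice because the diagonal rule bridges gaps. Two seeds a diagonal gap apart grow
    into a 3 by 3 block in a corner; the block meets the third seed diagonally, and orthogonal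
    neighbours then fill the rest. The order of contamination is a certificate that [spreads] checks
    by computation, avoiding the intersection over all closed sets; [spreads_subset] makes it
    sound. *)

Fixpoint spreads {n m} (s t : seq (cell n m)) : bool :=
  if t is u :: t' then
    has (fun v => has (fun w => contaminates v w u) s) s && spreads (u :: s) t'
  else true.

(** Induction on [t] with [s] general, since each new cell joins the sources of the later ones. *)
Lemma spreads_subset {n m} (T : {set cell n m}) (s t : seq (cell n m)) :
  contamination_closed T -> {subset s <= T} -> spreads s t ->
  {subset s ++ t <= T}.
Proof.
move=> cT; elim: t s => [|u t IHt] s sT /=; first by rewrite cats0.
case/andP=> /hasP[v vs /hasP[w ws uvw]] /IHt sub x.
rewrite mem_cat inE orbCA => xsut; apply: sub; last first.
  by rewrite mem_cat inE -orbA.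
move=> y; rewrite inE => /predU1P[->|]; last exact: sT.
move/forallP/(_ u)/forallP/(_ v)/forallP/(_ w)/implyP: cT; apply.
by rewrite !sT.
Qed.

Lemma spreads_final_contaminated {n m} (s t : seq (cell n m)) :
  spreads s t -> (forall x, x \in s ++ t) ->
  final_contaminated [set x in s] = [set: cell n m].
Proof.
move=> st cover; apply/eqP; rewrite eqEsubset subsetT; apply/subsetP => x _.
have [/subsetP sS cS _] := final_contaminatedP [set x in s].
apply: spreads_subset cS _ st _ (cover x) => y ys.
by apply: sS; rewrite inE.
Qed.

(** Reduction modulo the side supplies the bound proofs; all coordinates used are in range. *)
Definition cell45 (i j : nat) : cell 4 5 :=
  (Ordinal (ltn_pmod i (isT : 0 < 4)), Ordinal (ltn_pmod j (isT : 0 < 5))).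

(* (1,1), (2,3), (4,5) in the 1-based numbering. *)
Definition seed : seq (cell 4 5) := [:: cell45 0 0; cell45 1 2; cell45 3 4].

(** In 0-based coordinates, the block (rows 1 to 3, columns 2 to 4) is complete at [(3, 2)]; then
    [(1, 1)] arises diagonally from [(0, 0)] and [(2, 2)]. *)
Definition spreading_order : seq (cell 4 5) :=
  [seq cell45 p.1 p.2 | p <-
    [:: (2, 3); (2, 4); (3, 3); (1, 3); (1, 4); (2, 2); (3, 2); (1, 1); (2, 1);
        (3, 1); (0, 1); (0, 2); (0, 3); (0, 4); (1, 0); (2, 0); (3, 0)]].

Lemma card_seed : #|[set x in seed]| = 3.
Proof. by rewrite cardsE; apply/card_uniqP. Qed.

Lemma final_contaminated_seed :
  final_contaminated [set x in seed] = [set: cell 4 5].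
Proof.
apply: (@spreads_final_contaminated _ _ _ spreading_order); first by vm_compute.
by case=> -[[|[|[|[|//]]]] ?] -[[|[|[|[|[|//]]]]] ?].
Qed.

Theorem mainTheorem2 :
  (exists S : {set cell 4 5},
     #|S| = 3 /\ final_contaminated S = [set: cell 4 5]) /\
  claimed_value 4 5 = 4 /\
  ~ (forall n m : nat, 1 <= n -> 1 <= m ->
       power_contamination_number n m = claimed_value n m).
Proof.
split; first by exists [set x in seed]; rewrite card_seed final_contaminated_seed.
split=> // /(_ 4 5 isT isT) claim.
(* Minimality against the seed set would give 4 <= 3. *)
have [_ /(_ [set x in seed])] := power_contamination_numberP 4 5.
by rewrite claim card_seed /contaminating final_contaminated_seed eqxx => /(_ isT).
Qed.
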